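(* Let $\Omega=(x_L,x_R)$ be a bounded interval, let $x_I\in\Omega$, $\Omega^-=(x_L,x_I)$, $\Omega^+=(x_I,x_R)$. Let $\beta,f$ be functions on $\Omega^-\cup\Omega^+$ whose restrictions to each of $\Omega^-$ and $\Omega^+$ extend to smooth functions on the respective closed interval, with the extensions of $\beta$ strictly positive. Let $a_I,b_I,g_L,g_R\in\mathbb{R}$. Let $u$ be the exact solution, smooth up to the endpoints on each of $\Omega^-$ and $\Omega^+$, of $$(\beta u_x)_x=f \ \text{ in } \Omega^-\cup\Omega^+,\qquad u^+-u^-=a_I,\quad \beta^+u_x^+-\beta^-u_x^-=b_I \ \text{ at } x_I,$$ $$u(x_L)=g_L,\qquad u(x_R)=g_R,$$ where superscripts $\pm$ denote one-sided limits at $x_I$ from $\Omega^\pm$. For each uniform grid of spacing $\Delta x$ on $\Omega$ of which $x_I$ is not a grid point, let $\mathbf{U}$ be the numerical solution, i.e. the solution of the linear system $A\mathbf{U}=\mathbf{F}$ given by the finite difference scheme described in the context, and let $\mathbf{U}_{ex}$ be the vector of values of $u$ at the interior grid points. Then the numerical solution converges to the exact solution in the (discrete) $L^2$ norm with second-order accuracy: $$\|\mathbf{U}-\mathbf{U}_{ex}\|_2=O(\Delta x^2)\qquad\text{as } \Delta x\to 0,$$ that is, there are constants $C,h_0>0$ independent of the grid such that $\|\mathbf{U}-\mathbf{U}_{ex}\|_2\le C\,\Delta x^2$ for all such grids with $\Delta x\le h_0$.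
   Context: Grid: $x_j=x_L+j\Delta x$, $j=0,\dots,N$, with $\Delta x=(x_R-x_L)/N$; unknowns $\mathbf{U}=(u_1,\dots,u_{N-1})$; $u_0=g_L$ and $u_N=g_R$ are prescribed (their contributions are moved to the right-hand side). The discrete norm is $\|\mathbf{v}\|_2=\big(\Delta x\sum_{j=1}^{N-1}v_j^2\big)^{1/2}$. Write $f_j=f(x_j)$ and $\beta_{j\pm\frac12}=\beta(x_j\pm\Delta x/2)$. Let $i$ be the index with $x_i<x_I<x_{i+1}$ (so $x_i\in\Omega^-$, $x_{i+1}\in\Omega^+$; $\Delta x$ is small enough that $1\le i$ and $i+1\le N-1$). Define $\theta=(x_{i+1}-x_I)/\Delta x\in(0,1)$, $x_{m-}=(x_i+x_I)/2$, $x_{m+}=(x_I+x_{i+1})/2$, $\beta_{m\pm}=\beta(x_{m\pm})$, $f_{I\pm}=\lim_{x\to x_I^{\pm}}f(x)$, and $$\hat\beta=\frac{\beta_{m+}\beta_{m-}}{(1-\theta)\beta_{m+}+\theta\beta_{m-}}.$$ The scheme ($A\mathbf{U}=\mathbf{F}$) consists of the following equations. (1) At standard points $x_j$ ($1\le j\le N-1$, $j\ne i,i+1$): $$\frac{1}{\Delta x}\left(\beta_{j+\frac12}\frac{u_{j+1}-u_j}{\Delta x}-\beta_{j-\frac12}\frac{u_j-u_{j-1}}{\Delta x}\right)=f_j.$$ (2) At the nonstandard point $x_i$: $$\frac{1}{\Delta x^2}\Big(\beta_{i-\frac12}u_{i-1}-(\beta_{i-\frac12}+\hat\beta)u_i+\hat\beta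 u_{i+1}\Big)=f_i\,\frac{2-\theta}{2}+\frac{\hat\beta\theta}{\beta_{m+}}\left(\frac{\beta_{m+}}{\theta}\frac{a_I}{\Delta x^2}+\frac{b_I}{\Delta x}+\frac12\big(\theta f_{I+}+(1-\theta)f_{I-}\big)\right).$$ (3) At the nonstandard point $x_{i+1}$: $$\frac{1}{\Delta x^2}\Big(\hat\beta u_i-(\hat\beta+\beta_{i+\frac32})u_{i+1}+\beta_{i+\frac32}u_{i+2}\Big)=f_{i+1}\,\frac{1+\theta}{2}+\frac{\hat\beta(1-\theta)}{\beta_{m-}}\left(-\frac{\beta_{m-}}{1-\theta}\frac{a_I}{\Delta x^2}+\frac{b_I}{\Delta x}+\frac12\big(\theta f_{I+}+(1-\theta)f_{I-}\big)\right),$$ where $\beta_{i+\frac32}=\beta(x_{i+1}+\Delta x/2)$. *)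

(* Defs.v *)
From Stdlib Require Import Reals.
From Coquelicot Require Import Coquelicot.
Open Scope R_scope.

(* [g] is infinitely differentiable on the closed interval [a, b]: [d n] is the
   n-th derivative, with difference quotients taken inside [a, b] only (so the
   derivatives at the end points are one-sided). *)
Definition smooth_on (a b : R) (g : R -> R) : Prop :=
  exists d : nat -> R -> R,
    (forall x, a <= x <= b -> d 0%nat x = g x) /\
    (forall n x, a <= x <= b ->
       D_in (d n) (d (S n)) (fun y => a <= y <= b) x).

Definition extends_smoothly (a b : R) (g : R -> R) : Prop :=
  exists gt : R -> R,
    smooth_on a b gt /\ (forall x, a < x < b -> gt x = g x).

Definition extends_smoothly_pos (a b : R) (g : R -> R) : Prop :=
  exists gt : R -> R,
    smooth_on a b gt /\ (forall x, a < x < b -> gt x = g x) /\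
    (forall x, a <= x <= b -> 0 < gt x).

Definition left_lim (g : R -> R) (x l : R) : Prop :=
  filterlim g (at_left x) (locally l).

Definition right_lim (g : R -> R) (x l : R) : Prop :=
  filterlim g (at_right x) (locally l).

(* The value [u xI] is irrelevant; the values [u xL] and [u xR] belong to the
   smooth one-sided pieces of [u], so that the boundary conditions can be read
   literally. *)
Record exact_solution (xL xR xI : R) (beta f : R -> R) (aI bI gL gR : R)
    (u : R -> R) : Prop := {
  es_smooth_left : exists ut : R -> R,
    smooth_on xL xI ut /\ (forall x, xL <= x < xI -> ut x = u x);
  es_smooth_right : exists ut : R -> R,
    smooth_on xI xR ut /\ (forall x, xI < x <= xR -> ut x = u x);
  es_ode : forall x, xL < x < xI \/ xI < x < xR ->
    is_derive (fun y => beta y * Derive u y) x (f x);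
  es_jump : exists um up : R,
    left_lim u xI um /\ right_lim u xI up /\ up - um = aI;
  es_flux_jump : exists betam betap uxm uxp : R,
    left_lim beta xI betam /\ right_lim beta xI betap /\
    left_lim (Derive u) xI uxm /\ right_lim (Derive u) xI uxp /\
    betap * uxp - betam * uxm = bI;
  es_left : u xL = gL;
  es_right : u xR = gR
}.

Definition spacing (xL xR : R) (N : nat) : R := (xR - xL) / INR N.

Definition grid (xL xR : R) (N j : nat) : R := xL + INR j * spacing xL xR N.

(* The system for the unknowns [U 1], ..., [U (N - 1)].  The prescribed values
   are kept as [U 0] and [U N]; the values of [U] beyond [N] play no role.
   [i] is the index of the cell containing [xI], and [fIm], [fIp] are the
   one-sided limits of [f] at [xI]. *)
Definition scheme (xL xR xI : R) (beta f : R -> R) (aI bI gL gR fIm fIp : R)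
    (N i : nat) (U : nat -> R) : Prop :=
  let h := spacing xL xR N in
  let x := grid xL xR N in
  let theta := (x (i + 1)%nat - xI) / h in
  let bm := beta ((x i + xI) / 2) in
  let bp := beta ((xI + x (i + 1)%nat) / 2) in
  let bhat := bp * bm / ((1 - theta) * bp + theta * bm) in
  let fI := / 2 * (theta * fIp + (1 - theta) * fIm) in
  U 0%nat = gL /\ U N = gR /\
  (forall j : nat, (1 <= j <= N - 1)%nat -> j <> i -> j <> (i + 1)%nat ->
     1 / h * (beta (x j + h / 2) * ((U (j + 1)%nat - U j) / h)
              - beta (x j - h / 2) * ((U j - U (j - 1)%nat) / h)) = f (x j)) /\
  1 / h ^ 2 * (beta (x i - h / 2) * U (i - 1)%nat
               - (beta (x i - h / 2) + bhat) * U i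
               + bhat * U (i + 1)%nat)
  = f (x i) * ((2 - theta) / 2)
    + bhat * theta / bp * (bp / theta * (aI / h ^ 2) + bI / h + fI) /\
  1 / h ^ 2 * (bhat * U i
               - (bhat + beta (x (i + 1)%nat + h / 2)) * U (i + 1)%nat
               + beta (x (i + 1)%nat + h / 2) * U (i + 2)%nat)
  = f (x (i + 1)%nat) * ((1 + theta) / 2)
    + bhat * (1 - theta) / bm
      * (- (bm / (1 - theta)) * (aI / h ^ 2) + bI / h + fI).

Definition discrete_norm (xL xR : R) (N : nat) (v : nat -> R) : R :=
  sqrt (spacing xL xR N * sum_n_m (fun j => v j ^ 2) 1 (N - 1)).

(* Main.v *)
(* Write the scheme as a balance of edge fluxes [K j * (U (j + 1) - U j) / h],
   where the interface edge carries the harmonic mean [bhat].  For the exact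
   solution, these fluxes equal fluxes [P j] up to O(h^2): away from the
   interface [P j] is [beta u'] at the midpoint of the edge.  The [P j] satisfy
   the balance equations up to O(h^3) at standard points and up to O(h^2) at the
   two interface points.  Summing the balance equations over the O(1/h) nodes,
   the edge fluxes of the error are a constant plus O(h^2).  The error vanishes
   at both ends, so it cannot be strictly monotone, which forces the constant to
   be O(h^2); summing the increments then gives an O(h^2) bound on the error in
   the maximum norm. *)
Require Import Defs.
From Stdlib Require Import Reals Arith Lra Lia Psatz.
From Coquelicot Require Import Coquelicot.
Open Scope R_scope.

(** * Calculus with one-sided derivatives on a closed interval *)

Definition segment (a b : R) : R -> Prop := fun y => a <= y <= b.

Lemma D_in_is_derive (a b x : R) (g g' : R -> R) :
  a < x < b -> D_in g g' (segment a b) x -> is_derive g x (g' x).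
Proof.
  intros Hx H. apply is_derive_Reals. intros eps Heps.
  destruct (H eps Heps) as (al & Hal & Hlim).
  assert (Hd : 0 < Rmin al (Rmin (x - a) (b - x))) by
    (repeat apply Rmin_glb_lt; lra).
  exists (mkposreal _ Hd); intros t Ht0 Ht; simpl in Ht.
  assert (Hal' : Rabs t < al) by (eapply Rlt_le_trans; [exact Ht | apply Rmin_l]).
  assert (Hab : Rabs t < Rmin (x - a) (b - x)) by
    (eapply Rlt_le_trans; [exact Ht | apply Rmin_r]).
  assert (Ha : Rabs t < x - a) by (eapply Rlt_le_trans; [exact Hab | apply Rmin_l]).
  assert (Hb : Rabs t < b - x) by (eapply Rlt_le_trans; [exact Hab | apply Rmin_r]).
  apply Rabs_def2 in Ha; apply Rabs_def2 in Hb.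
  specialize (Hlim (x + t)). simpl in Hlim. unfold R_dist in Hlim.
  replace (x + t - x) with t in Hlim by ring.
  apply Hlim. split; [split; [unfold segment; lra | lra] | exact Hal'].
Qed.

Lemma continue_in_segment (a b x : R) (g g' : R -> R) :
  D_in g g' (segment a b) x ->
  forall eps, 0 < eps -> exists al, 0 < al /\
    forall y, a <= y <= b -> Rabs (y - x) < al -> Rabs (g y - g x) < eps.
Proof.
  intros H eps Heps.
  destruct (cont_deriv _ _ _ _ H eps Heps) as (al & Hal & Hlim).
  exists al; split; [exact Hal |]; intros y Hy Hyx.
  destruct (Req_dec x y) as [-> | Hne].
  - rewrite Rminus_diag, Rabs_R0; exact Heps.
  - apply (Hlim y). split; [split; [exact Hy | exact Hne] | exact Hyx].
Qed.

(** Projection onto [[a, b]]. Composing with it turns continuity relative to the segment into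
    two-sided continuity, the form in which the mean value and extreme value theorems are applied
    below. *)
Definition clamp (a b t : R) : R := Rmax a (Rmin b t).

Lemma clamp_id (a b t : R) : a <= t <= b -> clamp a b t = t.
Proof. intros H; unfold clamp; rewrite Rmin_right, Rmax_right; lra. Qed.

Lemma clamp_in (a b t : R) : a <= b -> a <= clamp a b t <= b.
Proof.
  intros H; unfold clamp; split; [apply Rmax_l |].
  apply Rmax_lub; [exact H | apply Rmin_l].
Qed.

Lemma clamp_contract (a b t x : R) :
  a <= x <= b -> Rabs (clamp a b t - x) <= Rabs (t - x).
Proof.
  intros H; unfold clamp, Rmax, Rmin.
  destruct (Rle_dec b t); destruct (Rle_dec a _);
    unfold Rabs; repeat destruct (Rcase_abs _); lra.
Qed.

Lemma clamp_continuity (a b x : R) (g g' : R -> R) :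
  a <= x <= b -> D_in g g' (segment a b) x ->
  continuity_pt (fun t => g (clamp a b t)) x.
Proof.
  intros Hx H eps Heps.
  destruct (continue_in_segment _ _ _ _ _ H eps Heps) as (al & Hal & Hlim).
  exists al; split; [exact Hal |]; intros y [_ Hy]; simpl in *; unfold R_dist in *.
  rewrite (clamp_id a b x) by exact Hx.
  apply Hlim; [apply clamp_in; lra |].
  eapply Rle_lt_trans; [apply clamp_contract; exact Hx | exact Hy].
Qed.

Definition D_on (a b : R) (g g' : R -> R) : Prop :=
  forall x, a <= x <= b -> D_in g g' (segment a b) x.

(** The mean value theorem is applied to [g] composed with [clamp], which coincides with [g] near
    every interior point. The intermediate point is kept no farther from [m] than [t], so that
    powers of the distance to [m] can be compared. *)
Lemma D_on_MVT (a b : R) (g g' : R -> R) (m t : R) :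
  D_on a b g g' -> a <= m <= b -> a <= t <= b ->
  exists c, a <= c <= b /\ Rabs (c - m) <= Rabs (t - m) /\
    g t - g m = g' c * (t - m).
Proof.
  intros H Hm Ht.
  destruct (MVT_gen (fun t => g (clamp a b t)) m t g') as (c & Hc & Heq).
  - intros x Hx.
    assert (Hab : a < x < b).
    { revert Hx; unfold Rmin, Rmax; destruct (Rle_dec m t); lra. }
    apply is_derive_ext_loc with g.
    + assert (Hd : 0 < Rmin (x - a) (b - x)) by (apply Rmin_glb_lt; lra).
      exists (mkposreal _ Hd); intros y Hy.
      unfold ball in Hy; simpl in Hy; unfold AbsRing_ball, abs, minus, plus, opp in Hy; simpl in Hy.
      rewrite clamp_id; [reflexivity |].
      assert (H1 : Rabs (y + - x) < x - a) by (eapply Rlt_le_trans; [exact Hy | apply Rmin_l]).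
      assert (H2 : Rabs (y + - x) < b - x) by (eapply Rlt_le_trans; [exact Hy | apply Rmin_r]).
      apply Rabs_def2 in H1; apply Rabs_def2 in H2; lra.
    + apply D_in_is_derive with a b; [exact Hab | apply H; lra].
  - intros x Hx.
    assert (Hab : a <= x <= b).
    { revert Hx; unfold Rmin, Rmax; destruct (Rle_dec m t); lra. }
    apply clamp_continuity with g'; [exact Hab | apply H; exact Hab].
  - rewrite !clamp_id in Heq by assumption.
    exists c; revert Hc; unfold Rmin, Rmax; destruct (Rle_dec m t); intros Hc;
      (split; [lra | split; [| exact Heq]]);
      unfold Rabs; repeat destruct (Rcase_abs _); lra.
Qed.

Lemma D_on_bounded (a b : R) (g g' : R -> R) :
  a <= b -> D_on a b g g' ->
  exists M, 0 <= M /\ forall x, a <= x <= b -> Rabs (g x) <= M.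
Proof.
  intros Hab H.
  assert (Hc : forall c, a <= c <= b -> continuity_pt (fun t => g (clamp a b t)) c)
    by (intros c Hc; apply clamp_continuity with g'; [exact Hc | apply H; exact Hc]).
  destruct (continuity_ab_maj _ a b Hab Hc) as (y & Hy & Hyab).
  destruct (continuity_ab_min _ a b Hab Hc) as (z & Hz & Hzab).
  exists (Rabs (g y) + Rabs (g z)).
  pose proof (Rabs_pos (g y)); pose proof (Rabs_pos (g z)).
  split; [lra |]; intros x Hx.
  specialize (Hy x Hx); specialize (Hz x Hx).
  rewrite !clamp_id in Hy, Hz by assumption.
  revert Hy Hz; unfold Rabs; repeat destruct (Rcase_abs _); lra.
Qed.

Lemma D_on_positive_min (a b : R) (g g' : R -> R) :
  a <= b -> D_on a b g g' -> (forall x, a <= x <= b -> 0 < g x) ->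
  exists k, 0 < k /\ forall x, a <= x <= b -> k <= g x.
Proof.
  intros Hab H Hpos.
  assert (Hc : forall c, a <= c <= b -> continuity_pt (fun t => g (clamp a b t)) c)
    by (intros c Hc; apply clamp_continuity with g'; [exact Hc | apply H; exact Hc]).
  destruct (continuity_ab_min _ a b Hab Hc) as (z & Hz & Hzab).
  exists (g z); split; [apply Hpos; exact Hzab |]; intros x Hx.
  specialize (Hz x Hx); rewrite !clamp_id in Hz by assumption; exact Hz.
Qed.

(** Serves to subtract Taylor polynomials, differentiable on the whole line, from functions
    differentiable only within the segment. *)
Lemma D_on_minus_derivable (a b : R) (g g' q q' : R -> R) :
  D_on a b g g' -> (forall x, is_derive q x (q' x)) ->
  D_on a b (fun x => g x - q x) (fun x => g' x - q' x).
Proof.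
  intros Hg Hq x Hx.
  apply (Dminus _ g' q' g q); [apply Hg; exact Hx |].
  intros eps Heps.
  destruct (proj1 (is_derive_Reals _ _ _) (Hq x) eps Heps) as (al & Hal).
  exists al; split; [apply cond_pos |]; simpl; unfold R_dist; intros y [[_ Hne] Hy].
  specialize (Hal (y - x)); replace (x + (y - x)) with y in Hal by ring.
  apply Hal; [lra | exact Hy].
Qed.

(** * Taylor remainders and quadrature estimates *)

(** One step of Taylor's theorem: as [r] vanishes at [m], the mean value theorem gains one power of
    the distance. The factor 1/(n+1) that integration would give is given up, so [M] stays the same
    at every order. *)
Lemma D_on_remainder (a b m M : R) (n : nat) (r r' : R -> R) :
  a <= m <= b -> 0 <= M -> D_on a b r r' -> r m = 0 ->
  (forall t, a <= t <= b -> Rabs (r' t) <= M * Rabs (t - m) ^ n) ->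
  forall t, a <= t <= b -> Rabs (r t) <= M * Rabs (t - m) ^ S n.
Proof.
  intros Hm HM HD Hrm Hr t Ht.
  destruct (D_on_MVT a b r r' m t HD Hm Ht) as (c & Hc & Hcm & Heq).
  replace (r t) with (r' c * (t - m)) by lra.
  rewrite Rabs_mult; simpl.
  replace (M * (Rabs (t - m) * Rabs (t - m) ^ n))
    with ((M * Rabs (t - m) ^ n) * Rabs (t - m)) by ring.
  apply Rmult_le_compat_r; [apply Rabs_pos |].
  eapply Rle_trans; [apply Hr; exact Hc |].
  apply Rmult_le_compat_l; [exact HM |].
  apply pow_incr; split; [apply Rabs_pos | exact Hcm].
Qed.

(** In the expansion of [g] about the midpoint, the quadratic terms at the two ends are equal and
    cancel. Two remainders are left, each at most [M * ((y - x) / 2) ^ 3]. *)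
Lemma midpoint_rule (a b M : R) (g g1 g2 g3 : R -> R) :
  0 <= M -> D_on a b g g1 -> D_on a b g1 g2 -> D_on a b g2 g3 ->
  (forall x, a <= x <= b -> Rabs (g3 x) <= M) ->
  forall x y, a <= x <= y -> y <= b ->
    Rabs (g y - g x - (y - x) * g1 ((x + y) / 2)) <= M * (y - x) ^ 3.
Proof.
  intros HM H0 H1 H2 H3 x y Hxy Hyb.
  set (m := (x + y) / 2).
  assert (Hm : a <= m <= b) by (unfold m; lra).
  (* [R2], [R1] and [R0] bound the Taylor remainders of [g2], [g1] and [g] about [m], each obtained
     from the previous one. *)
  assert (R2 : forall t, a <= t <= b -> Rabs (g2 t - g2 m) <= M * Rabs (t - m) ^ 1).
  { apply (D_on_remainder a b m M 0 (fun t => g2 t - g2 m) (fun t => g3 t - 0));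
      [exact Hm | exact HM | | ring |].
    - apply (D_on_minus_derivable a b g2 g3 (fun _ => g2 m) (fun _ => 0)); [exact H2 |].
      intros t; apply @is_derive_const.
    - intros t Ht; rewrite Rminus_0_r, Rmult_1_r; apply H3; exact Ht. }
  assert (R1 : forall t, a <= t <= b ->
    Rabs (g1 t - (g1 m + (t - m) * g2 m)) <= M * Rabs (t - m) ^ 2).
  { apply (D_on_remainder a b m M 1 (fun t => g1 t - (g1 m + (t - m) * g2 m))
             (fun t => g2 t - g2 m)); [exact Hm | exact HM | | ring | exact R2].
    apply (D_on_minus_derivable a b g1 g2 _ (fun _ => g2 m)); [exact H1 |].
    intros t; auto_derive; [trivial | ring]. }
  assert (R0 : forall t, a <= t <= b ->
    Rabs (g t - (g m + (t - m) * g1 m + (t - m) ^ 2 / 2 * g2 m)) <= M * Rabs (t - m) ^ 3).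
  { apply (D_on_remainder a b m M 2
             (fun t => g t - (g m + (t - m) * g1 m + (t - m) ^ 2 / 2 * g2 m))
             (fun t => g1 t - (g1 m + (t - m) * g2 m)));
      [exact Hm | exact HM | | field | exact R1].
    apply (D_on_minus_derivable a b g g1 _ (fun t => g1 m + (t - m) * g2 m)); [exact H0 |].
    intros t; auto_derive; [trivial | field]. }
  pose proof (R0 x ltac:(lra)) as Rx; pose proof (R0 y ltac:(lra)) as Ry.
  replace (y - m) with ((y - x) / 2) in Ry by (unfold m; field).
  replace (x - m) with (- ((y - x) / 2)) in Rx by (unfold m; field).
  rewrite Rabs_Ropp in Rx.
  rewrite (Rabs_pos_eq ((y - x) / 2)) in Rx, Ry by lra.
  replace (g y - g x - (y - x) * g1 m) with
    ((g y - (g m + (y - x) / 2 * g1 m + ((y - x) / 2) ^ 2 / 2 * g2 m)) +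
     - (g x - (g m + - ((y - x) / 2) * g1 m + (- ((y - x) / 2)) ^ 2 / 2 * g2 m))) by field.
  eapply Rle_trans; [apply Rabs_triang |].
  rewrite Rabs_Ropp.
  assert (0 <= M * (y - x) ^ 3) by (apply Rmult_le_pos; [exact HM | apply pow_le; lra]).
  replace (((y - x) / 2) ^ 3) with ((y - x) ^ 3 / 8) in Rx, Ry by field.
  lra.
Qed.

(** Two mean value steps give a product of lengths at most [2 * H] and [3 * H]. The evaluation point
    [z] need not be centred, so the order is only two; this serves the uneven intervals next to the
    interface. *)
Lemma one_point_rule (a b M H x y z : R) (g g1 g2 : R -> R) :
  D_on a b g g1 -> D_on a b g1 g2 ->
  (forall t, a <= t <= b -> Rabs (g2 t) <= M) ->
  a <= x <= b -> a <= y <= b -> a <= z <= b ->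
  Rabs (x - z) <= H -> Rabs (y - z) <= H ->
  Rabs (g y - g x - (y - x) * g1 z) <= 6 * M * H ^ 2.
Proof.
  intros H0 H1 H2 Hx Hy Hz Hxz Hyz.
  destruct (D_on_MVT a b g g1 x y H0 Hx Hy) as (c & Hc & Hcx & E).
  destruct (D_on_MVT a b g1 g2 z c H1 Hz Hc) as (d & Hd & _ & E').
  replace (g y - g x - (y - x) * g1 z) with (g2 d * ((c - z) * (y - x)))
    by (rewrite E; replace (g1 c) with (g1 z + g2 d * (c - z)) by lra; ring).
  rewrite !Rabs_mult.
  assert (Hyx : Rabs (y - x) <= 2 * H).
  { replace (y - x) with ((y - z) + - (x - z)) by ring.
    eapply Rle_trans; [apply Rabs_triang |]; rewrite Rabs_Ropp; lra. }
  assert (Hcz : Rabs (c - z) <= 3 * H).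
  { replace (c - z) with ((c - x) + (x - z)) by ring.
    eapply Rle_trans; [apply Rabs_triang |]; lra. }
  replace (6 * M * H ^ 2) with (M * (3 * H * (2 * H))) by ring.
  apply Rmult_le_compat; [apply Rabs_pos | | apply H2; exact Hd |].
  - apply Rmult_le_pos; apply Rabs_pos.
  - apply Rmult_le_compat; solve [apply Rabs_pos | assumption].
Qed.

(** * One-sided limits as end point values *)

(** Uniqueness of limits, as [g] is continuous at [b] from within the segment. This and its mirror
    image translate the jump conditions into values of the smooth extensions. *)
Lemma left_lim_D_on (a b l : R) (g g' phi : R -> R) :
  a < b -> D_on a b g g' -> (forall x, a < x < b -> g x = phi x) ->
  left_lim phi b l -> l = g b.
Proof.
  intros Hab HD Hphi Hl.
  apply (filterlim_locally_unique (F := at_left b) phi l (g b)); [exact Hl |].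
  intros P [eps HP].
  destruct (continue_in_segment a b b g g' (HD b ltac:(lra)) eps (cond_pos eps))
    as (al & Hal & Hlim).
  assert (Hd : 0 < Rmin al (b - a)) by (apply Rmin_glb_lt; lra).
  exists (mkposreal _ Hd); intros y Hy Hyb; apply HP.
  change (Rabs (y - b) < Rmin al (b - a)) in Hy.
  assert (H1 : Rabs (y - b) < al) by (eapply Rlt_le_trans; [exact Hy | apply Rmin_l]).
  assert (H2 : Rabs (y - b) < b - a) by (eapply Rlt_le_trans; [exact Hy | apply Rmin_r]).
  apply Rabs_def2 in H2.
  change (Rabs (phi y - g b) < eps).
  rewrite <- Hphi by lra; apply Hlim; [lra | exact H1].
Qed.

Lemma right_lim_D_on (a b l : R) (g g' phi : R -> R) :
  a < b -> D_on a b g g' -> (forall x, a < x < b -> g x = phi x) ->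
  right_lim phi a l -> l = g a.
Proof.
  intros Hab HD Hphi Hl.
  apply (filterlim_locally_unique (F := at_right a) phi l (g a)); [exact Hl |].
  intros P [eps HP].
  destruct (continue_in_segment a b a g g' (HD a ltac:(lra)) eps (cond_pos eps))
    as (al & Hal & Hlim).
  assert (Hd : 0 < Rmin al (b - a)) by (apply Rmin_glb_lt; lra).
  exists (mkposreal _ Hd); intros y Hy Hya; apply HP.
  change (Rabs (y - a) < Rmin al (b - a)) in Hy.
  assert (H1 : Rabs (y - a) < al) by (eapply Rlt_le_trans; [exact Hy | apply Rmin_l]).
  assert (H2 : Rabs (y - a) < b - a) by (eapply Rlt_le_trans; [exact Hy | apply Rmin_r]).
  apply Rabs_def2 in H2.
  change (Rabs (phi y - g a) < eps).
  rewrite <- Hphi by lra; apply Hlim; [lra | exact H1].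
Qed.

(** The difference is continuous and vanishes inside, so its limits at the ends vanish too. This
    carries the differential equation to the end points. *)
Lemma D_on_endpoint_eq (a b : R) (g g' k k' : R -> R) :
  a < b -> D_on a b g g' -> D_on a b k k' ->
  (forall x, a < x < b -> g x = k x) -> forall x, a <= x <= b -> g x = k x.
Proof.
  intros Hab Hg Hk Heq.
  assert (Hz : D_on a b (fun x => g x - k x) (fun x => g' x - k' x))
    by (intros x Hx; apply (Dminus _ g' k' g k); [apply Hg | apply Hk]; exact Hx).
  assert (E0 : forall x, a < x < b -> g x - k x = 0) by (intros x Hx; rewrite Heq; lra).
  intros x Hx; destruct (Req_dec x a) as [-> | Hxa]; [| destruct (Req_dec x b) as [-> | Hxb]].
  - assert (0 = g a - k a); [| lra].
    apply (right_lim_D_on a b 0 _ _ (fun _ => 0) Hab Hz E0), filterlim_const.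
  - assert (0 = g b - k b); [| lra].
    apply (left_lim_D_on a b 0 _ _ (fun _ => 0) Hab Hz E0), filterlim_const.
  - apply Heq; lra.
Qed.

(** * Smooth pieces of the data and of the solution on either side *)

(** The zeroth derivative may be replaced by [g] itself, since the difference quotients only see
    points of the segment, where the two agree. *)
Lemma smooth_on_D_on (a b : R) (g : R -> R) :
  a < b -> smooth_on a b g ->
  exists d : nat -> R -> R, d 0%nat = g /\ forall n, D_on a b (d n) (d (S n)).
Proof.
  intros Hab (d & H0 & Hd).
  exists (fun n => match n with 0%nat => g | S n => d (S n) end).
  split; [reflexivity |]; intros [| n] x Hx; [| apply Hd; exact Hx].
  intros eps Heps; destruct (Hd 0%nat x Hx eps Heps) as (al & Hal & Hlim).
  exists al; split; [exact Hal |]; intros y Hy.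
  specialize (Hlim y Hy); rewrite !H0 in Hlim; [exact Hlim | exact Hx | apply Hy].
Qed.

(* [bt], [ft], [ut], [vt] are the extensions of [beta], [f], [u], [u'] to the
   closed interval, so [bt * vt] is the flux. *)
Record piece (a b : R) (beta f u bt ft ut vt : R -> R) (k M : R) : Prop := {
  pc_beta : forall x, a < x < b -> bt x = beta x;
  pc_f : forall x, a < x < b -> ft x = f x;
  pc_u : forall x, a < x < b -> ut x = u x;
  pc_du : forall x, a < x < b -> vt x = Derive u x;
  pc_D_beta : exists b1, D_on a b bt b1;
  pc_D_f : exists f1, D_on a b ft f1;
  pc_D_u : exists u1, D_on a b ut u1;
  pc_D_v : exists v1, D_on a b vt v1;
  pc_bound : forall x, a <= x <= b -> k <= bt x <= M;
  pc_u_mid : forall x y, a <= x <= y -> y <= b ->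
    Rabs (ut y - ut x - (y - x) * vt ((x + y) / 2)) <= M * (y - x) ^ 3;
  pc_flux_mid : forall x y, a <= x <= y -> y <= b ->
    Rabs (bt y * vt y - bt x * vt x - (y - x) * ft ((x + y) / 2)) <= M * (y - x) ^ 3;
  pc_flux_one : forall x y z H, a <= x <= b -> a <= y <= b -> a <= z <= b ->
    Rabs (x - z) <= H -> Rabs (y - z) <= H ->
    Rabs (bt y * vt y - bt x * vt x - (y - x) * ft z) <= M * H ^ 2 }.

Arguments pc_beta {a b beta f u bt ft ut vt k M}.
Arguments pc_f {a b beta f u bt ft ut vt k M}.
Arguments pc_u {a b beta f u bt ft ut vt k M}.
Arguments pc_du {a b beta f u bt ft ut vt k M}.
Arguments pc_D_beta {a b beta f u bt ft ut vt k M}.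
Arguments pc_D_f {a b beta f u bt ft ut vt k M}.
Arguments pc_D_u {a b beta f u bt ft ut vt k M}.
Arguments pc_D_v {a b beta f u bt ft ut vt k M}.
Arguments pc_bound {a b beta f u bt ft ut vt k M}.
Arguments pc_u_mid {a b beta f u bt ft ut vt k M}.
Arguments pc_flux_mid {a b beta f u bt ft ut vt k M}.
Arguments pc_flux_one {a b beta f u bt ft ut vt k M}.

(** The flux is treated as a single function whose derivative on the closed interval is the
    extension of [f]. The quadrature rules then bound its increments through derivatives of [f]
    alone. *)
Lemma piece_exists (a b : R) (beta f u ut : R -> R) :
  a < b -> extends_smoothly_pos a b beta -> extends_smoothly a b f ->
  smooth_on a b ut -> (forall x, a < x < b -> ut x = u x) ->
  (forall x, a < x < b -> is_derive (fun y => beta y * Derive u y) x (f x)) ->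
  exists bt ft vt k M, 0 < k /\ 0 < M /\ piece a b beta f u bt ft ut vt k M.
Proof.
  intros Hab (b_ & Hb & Eb & Pb) (f_ & Hf & Ef) Hu EU Hode.
  destruct (smooth_on_D_on a b b_ Hab Hb) as (bd & Eb0 & Hbd).
  destruct (smooth_on_D_on a b f_ Hab Hf) as (fd & Ef0 & Hfd).
  destruct (smooth_on_D_on a b ut Hab Hu) as (ud & Eu0 & Hud); rewrite <- Eu0 in EU.
  assert (Ebeta : forall x, a < x < b -> bd 0%nat x = beta x)
    by (rewrite Eb0; exact Eb).
  assert (EF : forall x, a < x < b -> fd 0%nat x = f x)
    by (rewrite Ef0; exact Ef).
  assert (Hopen : forall x, a < x < b -> locally x (fun y => a < y < b)).
  { intros x Hx; apply (locally_interval _ x a b); simpl; try lra; intros y H1 H2; lra. }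
  assert (EV : forall x, a < x < b -> ud 1%nat x = Derive u x).
  { intros x Hx; symmetry; apply is_derive_unique.
    apply is_derive_ext_loc with (ud 0%nat).
    - apply filter_imp with (2 := Hopen x Hx); exact EU.
    - apply D_in_is_derive with a b; [exact Hx | apply Hud; lra]. }
  (* [p] is the flux and [q] its derivative by the product rule. *)
  set (p := fun x => bd 0%nat x * ud 1%nat x).
  set (q := fun x => bd 1%nat x * ud 1%nat x + bd 0%nat x * ud 2%nat x).
  assert (Hpq : D_on a b p q)
    by (intros x Hx; apply Dmult; [apply Hbd | apply Hud]; exact Hx).
  assert (Hq : exists q', D_on a b q q').
  { eexists; intros x Hx; apply Dadd; apply Dmult; solve [apply Hbd; exact Hx | apply Hud; exact Hx]. }
  destruct Hq as (q' & Hq').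
  assert (Eq : forall x, a <= x <= b -> q x = fd 0%nat x).
  { apply (D_on_endpoint_eq a b q q' (fd 0%nat) (fd 1%nat) Hab Hq' (Hfd 0%nat)).
    intros x Hx; rewrite EF by exact Hx.
    rewrite <- (is_derive_unique _ _ _ (Hode x Hx)); symmetry; apply is_derive_unique.
    apply is_derive_ext_loc with p.
    - apply filter_imp with (2 := Hopen x Hx); intros y Hy; unfold p.
      rewrite Ebeta, EV by exact Hy; reflexivity.
    - apply D_in_is_derive with a b; [exact Hx | apply Hpq; lra]. }
  assert (Hp : D_on a b p (fd 0%nat)).
  (* At a given point, [D_in] involves the derivative only through its value there, so equality on
     the segment suffices. *)
  { intros x Hx; unfold D_in; rewrite <- Eq by exact Hx; apply Hpq; exact Hx. }
  destruct (D_on_positive_min a b (bd 0%nat) _ ltac:(lra) (Hbd 0%nat)) as (k & Hk & Hkb).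
  { rewrite Eb0; exact Pb. }
  destruct (D_on_bounded a b _ _ ltac:(lra) (Hbd 0%nat)) as (Mb & HMb & Bb).
  destruct (D_on_bounded a b _ _ ltac:(lra) (Hud 3%nat)) as (Mu & HMu & Bu).
  destruct (D_on_bounded a b _ _ ltac:(lra) (Hfd 1%nat)) as (Mf & HMf & Bf).
  destruct (D_on_bounded a b _ _ ltac:(lra) (Hfd 2%nat)) as (Mg & HMg & Bg).
  (* The bound adds up the suprema of the coefficient, of the third derivative of the solution, of
     [f'] (with the 6 of [one_point_rule]) and of [f'']; the 1 makes it positive. *)
  exists (bd 0%nat), (fd 0%nat), (ud 1%nat), k, (1 + Mb + Mu + 6 * Mf + Mg).
  rewrite <- Eu0.
  split; [exact Hk |]; split; [lra |].
  constructor; eauto.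
  - intros x Hx; split; [apply Hkb; exact Hx |].
    eapply Rle_trans; [apply Rle_abs |]; specialize (Bb x Hx); lra.
  - intros x y Hxy Hyb.
    eapply Rle_trans; [apply (midpoint_rule a b Mu _ _ _ _ HMu (Hud 0%nat) (Hud 1%nat) (Hud 2%nat)); assumption |].
    apply Rmult_le_compat_r; [apply pow_le |]; lra.
  - intros x y Hxy Hyb.
    eapply Rle_trans; [apply (midpoint_rule a b Mg p _ _ _ HMg Hp (Hfd 0%nat) (Hfd 1%nat)); assumption |].
    apply Rmult_le_compat_r; [apply pow_le |]; lra.
  - intros x y z H Hx Hy Hz Hxz Hyz.
    eapply Rle_trans; [apply (one_point_rule a b Mf H x y z p _ _ Hp (Hfd 0%nat)); assumption |].
    apply Rmult_le_compat_r; [apply pow2_ge_0 | lra].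
Qed.

(** * Discrete stability and tridiagonal systems in flux form *)

(** The edge fluxes of [e] are an unknown constant [D] plus perturbations. If [D] exceeded [S0] in
    absolute value, all fluxes would have one sign. Hence each flux is at most [2 * S0], each
    increment at most [2 * S0 * h / k], and these add up. *)
Lemma discrete_stability (N : nat) (K e s : nat -> R) (k h D S0 : R) :
  0 < k -> 0 < h -> 0 <= S0 -> (0 < N)%nat ->
  (forall j, (j < N)%nat -> k <= K j) -> e 0%nat = 0 -> e N = 0 ->
  (forall j, (j < N)%nat -> K j * (e (S j) - e j) = h * (D + s j)) ->
  (forall j, (j < N)%nat -> Rabs (s j) <= S0) ->
  forall j, (j <= N)%nat -> Rabs (e j) <= INR j * (2 * S0 * h / k).
Proof.
  intros Hk Hh HS HN HK He0 HeN Heq Hs.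
  assert (Hpos : forall j, (j < N)%nat -> 0 < D + s j -> e j < e (S j)).
  { intros j Hj H; specialize (Heq j Hj); specialize (HK j Hj).
    assert (0 < h * (D + s j)) by (apply Rmult_lt_0_compat; lra); nra. }
  assert (Hneg : forall j, (j < N)%nat -> D + s j < 0 -> e (S j) < e j).
  { intros j Hj H; specialize (Heq j Hj); specialize (HK j Hj).
    assert (0 < h * - (D + s j)) by (apply Rmult_lt_0_compat; lra); nra. }
  (* otherwise [e] would be strictly monotone, contradicting [e 0 = e N] *)
  assert (HD : Rabs D <= S0).
  { apply Rabs_le; split; apply Rnot_lt_le; intros Hlt.
    - assert (Hm : forall j, (S j <= N)%nat -> e (S j) < 0).
      { intros j; induction j as [| j IH]; intros Hj.
        - rewrite <- He0; apply Hneg; [lia |].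
          specialize (Hs 0%nat ltac:(lia)); apply Rabs_le_between in Hs; lra.
        - apply Rlt_trans with (e (S j)); [| apply IH; lia]; apply Hneg; [lia |].
          specialize (Hs (S j) ltac:(lia)); apply Rabs_le_between in Hs; lra. }
      specialize (Hm (N - 1)%nat ltac:(lia)); replace (S (N - 1)) with N in Hm by lia; lra.
    - assert (Hm : forall j, (S j <= N)%nat -> 0 < e (S j)).
      { intros j; induction j as [| j IH]; intros Hj.
        - rewrite <- He0; apply Hpos; [lia |].
          specialize (Hs 0%nat ltac:(lia)); apply Rabs_le_between in Hs; lra.
        - apply Rlt_trans with (e (S j)); [apply IH; lia |]; apply Hpos; [lia |].
          specialize (Hs (S j) ltac:(lia)); apply Rabs_le_between in Hs; lra. }
      specialize (Hm (N - 1)%nat ltac:(lia)); replace (S (N - 1)) with N in Hm by lia; lra. }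
  intros j; induction j as [| j IH]; intros Hj.
  - rewrite He0, Rabs_R0; simpl; lra.
  - assert (Hstep : Rabs (e (S j) - e j) <= 2 * S0 * h / k).
    { specialize (Heq j ltac:(lia)); specialize (HK j ltac:(lia)); specialize (Hs j ltac:(lia)).
      apply Rmult_le_reg_l with k; [exact Hk |].
      replace (k * (2 * S0 * h / k)) with (h * (2 * S0)) by (field; lra).
      apply Rle_trans with (Rabs (K j * (e (S j) - e j))).
      - rewrite Rabs_mult, (Rabs_pos_eq (K j)) by lra.
        apply Rmult_le_compat_r; [apply Rabs_pos | exact HK].
      - rewrite Heq, Rabs_mult, (Rabs_pos_eq h) by lra.
        apply Rmult_le_compat_l; [lra |].
        eapply Rle_trans; [apply Rabs_triang | lra]. }
    replace (e (S j)) with (e j + (e (S j) - e j)) by ring.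
    rewrite S_INR, Rmult_plus_distr_r, Rmult_1_l.
    eapply Rle_trans; [apply Rabs_triang |]; apply Rplus_le_compat; [apply IH; lia | exact Hstep].
Qed.

Fixpoint partial_sum (G : nat -> R) (j : nat) : R :=
  match j with 0%nat => 0 | S j => partial_sum G j + G j end.

(** [K j] belongs to the edge from [j] to [S j]. Rows are indexed by [S j], which ranges over the
    interior nodes without subtraction on naturals. *)
Definition tridiagonal (N : nat) (K G : nat -> R) (gL gR : R) (V : nat -> R) : Prop :=
  V 0%nat = gL /\ V N = gR /\
  forall j, (S j < N)%nat ->
    K (S j) * (V (S (S j)) - V (S j)) - K j * (V (S j) - V j) = G (S j).

(** The system is solved by two summations: first the fluxes, then the increments. The right
    boundary value determines the free flux because [B N], a sum of positive terms, is nonzero. *)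
Lemma tridiagonal_exists (N : nat) (K G : nat -> R) (gL gR k : R) :
  0 < k -> (0 < N)%nat -> (forall j, (j < N)%nat -> k <= K j) ->
  exists V, tridiagonal N K G gL gR V.
Proof.
  intros Hk HN HK.
  (* shooting: [q] is the flux through the first edge *)
  set (A := partial_sum (fun j => partial_sum (fun i => G (S i)) j / K j)).
  set (B := partial_sum (fun j => / K j)).
  assert (HB : forall j, (S j <= N)%nat -> 0 < B (S j)).
  { intros j; induction j as [| j IH]; intros Hj; unfold B; simpl partial_sum.
    - rewrite Rplus_0_l; apply Rinv_0_lt_compat; specialize (HK 0%nat ltac:(lia)); lra.
    - apply Rplus_lt_0_compat; [exact (IH ltac:(lia)) |].
      apply Rinv_0_lt_compat; specialize (HK (S j) ltac:(lia)); lra. }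
  assert (HBN : 0 < B N) by (replace N with (S (N - 1)) by lia; apply HB; lia).
  set (q := (gR - gL - A N) / B N).
  exists (fun j => gL + A j + q * B j); split; [| split].
  - unfold A, B; simpl; ring.
  - unfold q; field; lra.
  - intros j Hj; pose proof (HK j ltac:(lia)); pose proof (HK (S j) Hj).
    unfold A, B; simpl; field; lra.
Qed.

Lemma tridiagonal_flux (N : nat) (K G V W : nat -> R) (gL gR : R) :
  tridiagonal N K G gL gR V -> tridiagonal N K G gL gR W ->
  forall j, (j < N)%nat ->
    K j * ((V (S j) - W (S j)) - (V j - W j)) = K 0%nat * ((V 1%nat - W 1%nat) - (V 0%nat - W 0%nat)).
Proof.
  intros (_ & _ & HV) (_ & _ & HW) j; induction j as [| j IH]; intros Hj; [reflexivity |].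
  rewrite <- IH by lia; specialize (HV j Hj); specialize (HW j Hj); lra.
Qed.

Lemma tridiagonal_unique (N : nat) (K G V W : nat -> R) (gL gR k : R) :
  0 < k -> (0 < N)%nat -> (forall j, (j < N)%nat -> k <= K j) ->
  tridiagonal N K G gL gR V -> tridiagonal N K G gL gR W ->
  forall j, (j <= N)%nat -> V j = W j.
Proof.
  intros Hk HN HK HV HW j Hj.
  assert (H : Rabs (V j - W j) <= INR j * (2 * 0 * 1 / k)).
  { apply (discrete_stability N K (fun j => V j - W j) (fun _ => 0) k 1
      (K 0%nat * ((V 1%nat - W 1%nat) - (V 0%nat - W 0%nat))) 0);
      try assumption; try lra.
    - destruct HV as (E1 & _), HW as (E2 & _); lra.
    - destruct HV as (_ & E1 & _), HW as (_ & E2 & _); lra.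
    - intros i Hi; rewrite (tridiagonal_flux N K G V W gL gR HV HW i Hi); ring.
    - intros; rewrite Rabs_R0; lra. }
  replace (INR j * (2 * 0 * 1 / k)) with 0 in H by (field; lra).
  pose proof (Rabs_pos (V j - W j)).
  apply Rminus_diag_uniq, Rabs_eq_0; lra.
Qed.

Lemma piece_weaken (a b k M k' M' : R) (beta f u bt ft ut vt : R -> R) :
  k' <= k -> M <= M' ->
  piece a b beta f u bt ft ut vt k M -> piece a b beta f u bt ft ut vt k' M'.
Proof.
  intros Hk HM [H1 H2 H3 H4 H5 H6 H7 H8 Hb Hu Hp H12]; constructor; try assumption.
  - intros x Hx; specialize (Hb x Hx); lra.
  - intros x y Hxy Hyb; eapply Rle_trans; [apply Hu; assumption |].
    apply Rmult_le_compat_r; [apply pow_le |]; lra.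
  - intros x y Hxy Hyb; eapply Rle_trans; [apply Hp; assumption |].
    apply Rmult_le_compat_r; [apply pow_le |]; lra.
  - intros x y z H Hx Hy Hz Hxz Hyz; eapply Rle_trans; [apply (H12 x y z H); assumption |].
    apply Rmult_le_compat_r; [apply pow2_ge_0 | exact HM].
Qed.

(** In the factor [L + 3], [L] comes from the at most [N] standard nodes with defect [c * h ^ 4], 2
    from the two interface nodes with defect [c * h ^ 3], and 1 from replacing the fluxes of [w] by
    [P]. The other [L] comes from summing the increments. *)
Lemma tridiagonal_convergence (N i : nat) (K G P V w : nat -> R) (k h c L : R) :
  0 < k -> 0 < h -> 0 <= c -> (0 < N)%nat -> INR N * h = L ->
  (forall j, (j < N)%nat -> k <= K j) ->
  tridiagonal N K G (w 0%nat) (w N) V ->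
  (forall j, (j < N)%nat -> Rabs (K j * (w (S j) - w j) - h * P j) <= c * h ^ 3) ->
  (forall j, (S j < N)%nat -> S j <> i -> j <> i ->
    Rabs (h * (P (S j) - P j) - G (S j)) <= c * h ^ 4) ->
  (forall j, (S j < N)%nat -> S j = i \/ j = i ->
    Rabs (h * (P (S j) - P j) - G (S j)) <= c * h ^ 3) ->
  forall j, (j <= N)%nat -> Rabs (V j - w j) <= 2 * c * (L + 3) * L / k * h ^ 2.
Proof.
  intros Hk Hh Hc HN HL HK (HV0 & HVN & HV) Hflux Hstd Hint.
  set (Dl := fun j => K j * (V (S j) - V j) - h * P j).
  assert (Hh3 : 0 <= c * h ^ 3) by (apply Rmult_le_pos; [| apply pow_le]; lra).
  (* Consecutive values of [Dl] differ by the defect of [P] at the node between them. The two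
     indicators count the interface nodes [i] and [S i] already passed. *)
  assert (HD : forall j, (j < N)%nat -> Rabs (Dl j - Dl 0%nat) <=
    INR j * (c * h ^ 4) + c * h ^ 3 *
      ((if le_dec i j then 1 else 0) + (if le_dec (S i) j then 1 else 0))).
  { intros j; induction j as [| j IH]; intros Hj.
    - rewrite Rminus_diag, Rabs_R0; change (INR 0) with 0.
      destruct (le_dec i 0); destruct (le_dec (S i) 0); lra.
    - specialize (IH ltac:(lia)).
      replace (Dl (S j) - Dl 0%nat) with
        ((Dl j - Dl 0%nat) + - (h * (P (S j) - P j) - G (S j)))
        by (unfold Dl; specialize (HV j Hj); lra).
      eapply Rle_trans; [apply Rabs_triang |]; rewrite Rabs_Ropp, S_INR.
      destruct (Nat.eq_dec (S j) i) as [Hi | Hi]; [| destruct (Nat.eq_dec j i) as [Hi' | Hi']].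
      + specialize (Hint j Hj (or_introl Hi)).
        assert (0 <= c * h ^ 4) by (apply Rmult_le_pos; [| apply pow_le]; lra).
        revert IH; repeat destruct (le_dec _ _); try lia; intros; lra.
      + specialize (Hint j Hj (or_intror Hi')).
        assert (0 <= c * h ^ 4) by (apply Rmult_le_pos; [| apply pow_le]; lra).
        revert IH; repeat destruct (le_dec _ _); try lia; intros; lra.
      + specialize (Hstd j Hj Hi Hi').
        revert IH; repeat destruct (le_dec _ _); try lia; intros; lra. }
  assert (HL0 : 0 < L) by (rewrite <- HL; apply Rmult_lt_0_compat; [apply lt_0_INR |]; assumption).
  intros j Hj.
  (* Chosen so that the edge flux of [V - w] is [h * (Dl 0 / h + s j)], as stability requires. *)
  set (s := fun j => (Dl j - Dl 0%nat - (K j * (w (S j) - w j) - h * P j)) / h).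
  assert (Hstab : Rabs (V j - w j) <= INR j * (2 * (c * (L + 3) * h ^ 2) * h / k)).
  { apply (discrete_stability N K (fun j => V j - w j) s k h (Dl 0%nat / h) (c * (L + 3) * h ^ 2));
      try assumption; try lra.
    - repeat apply Rmult_le_pos; try lra; apply pow_le; lra.
    - intros l Hl; unfold s, Dl; field; lra.
    - intros l Hl; unfold s; unfold Rdiv.
      rewrite Rabs_mult, (Rabs_pos_eq (/ h)) by (apply Rlt_le, Rinv_0_lt_compat; exact Hh).
      apply Rmult_le_reg_r with h; [exact Hh |].
      rewrite Rmult_assoc, Rinv_l, Rmult_1_r by lra.
      unfold Rminus at 1; eapply Rle_trans; [apply Rabs_triang |]; rewrite Rabs_Ropp.
      specialize (HD l Hl); specialize (Hflux l Hl).
      assert (Hl' : INR l * (c * h ^ 4) <= L * (c * h ^ 3)).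
      { rewrite <- HL; replace (INR N * h * (c * h ^ 3)) with (INR N * (c * h ^ 4)) by ring.
        apply Rmult_le_compat_r; [apply Rmult_le_pos; [| apply pow_le]; lra |].
        apply le_INR; lia. }
      replace (c * (L + 3) * h ^ 2 * h) with (L * (c * h ^ 3) + 3 * (c * h ^ 3)) by ring.
      revert HD; repeat destruct (le_dec _ _); intros; lra. }
  eapply Rle_trans; [exact Hstab |].
  replace (2 * c * (L + 3) * L / k * h ^ 2) with
    (INR N * (2 * (c * (L + 3) * h ^ 2) * h / k))
    by (rewrite <- HL; field; lra).
  apply Rmult_le_compat_r; [| apply le_INR; exact Hj].
  apply Rmult_le_pos; [| apply Rlt_le, Rinv_0_lt_compat; exact Hk].
  repeat apply Rmult_le_pos; try lra; apply pow_le; lra.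
Qed.

Lemma discrete_norm_le (xL xR E : R) (N : nat) (v : nat -> R) :
  xL < xR -> (0 < N)%nat -> 0 <= E -> (forall j, (j <= N)%nat -> Rabs (v j) <= E) ->
  discrete_norm xL xR N v <= sqrt (xR - xL) * E.
Proof.
  intros HLR HN HE Hv; unfold discrete_norm.
  assert (HN' : 0 < INR N) by (apply lt_0_INR; exact HN).
  assert (Hh : 0 < spacing xL xR N) by (unfold spacing; apply Rdiv_lt_0_compat; lra).
  rewrite <- (sqrt_pow2 E HE) at 1.
  rewrite <- sqrt_mult by (try apply pow2_ge_0; lra).
  apply sqrt_le_1_alt.
  replace (xR - xL) with (spacing xL xR N * INR N) by (unfold spacing; field; lra).
  rewrite Rmult_assoc; apply Rmult_le_compat_l; [lra |].
  apply Rle_trans with (sum_n_m (fun _ => E ^ 2) 1 (N - 1)).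
  (* The bound on [v] is known only up to [N], while the comparison of sums is made at every index;
     truncating by [Rmin] makes it hold everywhere. *)
  - rewrite (sum_n_m_ext_loc _ (fun j => Rmin (v j ^ 2) (E ^ 2))).
    + apply sum_n_m_le; intros; apply Rmin_r.
    + intros j Hj; symmetry; apply Rmin_left.
      apply pow_maj_Rabs, Hv; lia.
  - rewrite sum_n_m_const; apply Rmult_le_compat_r; [apply pow2_ge_0 |].
    apply le_INR; lia.
Qed.

(** * The scheme as a tridiagonal system *)

Definition edge_coeff (beta : R -> R) (x : nat -> R) (h bhat : R) (i j : nat) : R :=
  if Nat.eqb j i then bhat else beta (x j + h / 2).

(** The factor [h ^ 2] clears the denominators of the scheme, leaving plain differences of weighted
    increments on the left. *)
Definition node_rhs (f : R -> R) (x : nat -> R) (h th bm bp bhat aI bI fI : R)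
    (i j : nat) : R :=
  h ^ 2 *
  (if Nat.eqb j i then
     f (x j) * ((2 - th) / 2) + bhat * th / bp * (bp / th * (aI / h ^ 2) + bI / h + fI)
   else if Nat.eqb j (S i) then
     f (x j) * ((1 + th) / 2)
     + bhat * (1 - th) / bm * (- (bm / (1 - th)) * (aI / h ^ 2) + bI / h + fI)
   else f (x j)).

(** Equal to 1 / (th/bp + (1-th)/bm), the effective coefficient of two layers in series. *)
Definition weighted_harmonic_mean (th bm bp : R) : R :=
  bp * bm / ((1 - th) * bp + th * bm).

(** The first bounds keep the interface edge elliptic, the second control the weight of the flux
    jump, and the identity drives the cancellations at the interface. *)
Lemma weighted_harmonic_mean_bounds (th bm bp k M : R) :
  0 < th < 1 -> 0 < k -> k <= bm <= M -> k <= bp <= M ->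
  k <= weighted_harmonic_mean th bm bp <= M /\
  0 <= weighted_harmonic_mean th bm bp * th / bp <= 1 /\
  weighted_harmonic_mean th bm bp * (th / bp + (1 - th) / bm) = 1.
Proof.
  intros Hth Hk Hm Hp; unfold weighted_harmonic_mean.
  assert (Hd : 0 < (1 - th) * bp + th * bm)
    by (apply Rplus_lt_0_compat; apply Rmult_lt_0_compat; lra).
  split; [split | split; [split |]].
  - apply Rmult_le_reg_r with (1 := Hd); unfold Rdiv.
    rewrite Rmult_assoc, Rinv_l by lra.
    assert (0 <= (1 - th) * (bp * (bm - k)) + th * (bm * (bp - k))); [| nra].
    apply Rplus_le_le_0_compat; repeat apply Rmult_le_pos; lra.
  - apply Rmult_le_reg_r with (1 := Hd); unfold Rdiv.
    rewrite Rmult_assoc, Rinv_l by lra.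
    assert (0 <= (1 - th) * (bp * (M - bm)) + th * (bm * (M - bp))); [| nra].
    apply Rplus_le_le_0_compat; repeat apply Rmult_le_pos; lra.
  - replace (bp * bm / ((1 - th) * bp + th * bm) * th / bp)
      with (bm * th / ((1 - th) * bp + th * bm)) by (field; lra).
    apply Rmult_le_pos; [apply Rmult_le_pos; lra | apply Rlt_le, Rinv_0_lt_compat, Hd].
  - replace (bp * bm / ((1 - th) * bp + th * bm) * th / bp)
      with (bm * th / ((1 - th) * bp + th * bm)) by (field; lra).
    apply Rmult_le_reg_r with (1 := Hd); unfold Rdiv.
    rewrite Rmult_assoc, Rinv_l by lra.
    assert (0 <= (1 - th) * bp) by (apply Rmult_le_pos; lra); lra.
  - field; lra.
Qed.

Lemma scheme_tridiagonal (xL xR xI : R) (beta f : R -> R)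
    (aI bI gL gR fIm fIp : R) (N i : nat) (V : nat -> R) :
  let h := spacing xL xR N in
  let x := grid xL xR N in
  let th := (x (i + 1)%nat - xI) / h in
  let bm := beta ((x i + xI) / 2) in
  let bp := beta ((xI + x (i + 1)%nat) / 2) in
  let bhat := weighted_harmonic_mean th bm bp in
  let fI := / 2 * (th * fIp + (1 - th) * fIm) in
  0 < h -> (1 <= i)%nat -> (i + 2 <= N)%nat ->
  scheme xL xR xI beta f aI bI gL gR fIm fIp N i V <->
  tridiagonal N (edge_coeff beta x h bhat i)
    (node_rhs f x h th bm bp bhat aI bI fI i) gL gR V.
Proof.
  intros h x th bm bp bhat fI Hh Hi HiN.
  (* Both neighbours of an edge evaluate [beta] at the same midpoint, so one coefficient per edge
     suffices. *)
  assert (Hx : forall j, x (S j) - h / 2 = x j + h / 2)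
    by (intros j; unfold x, grid, h; rewrite S_INR; field).
  unfold scheme; cbv zeta; fold h; fold x; fold th; fold bm; fold bp; fold fI.
  change (bp * bm / ((1 - th) * bp + th * bm)) with bhat.
  unfold tridiagonal, edge_coeff, node_rhs.
  rewrite !Nat.add_1_r; replace (i + 2)%nat with (S (S i)) by lia.
  destruct i as [| l]; [lia |].
  replace (S l - 1)%nat with l by lia.
  rewrite (Hx l).
  split.
  - intros (H0 & HN & Hstd & Hm & Hp); split; [exact H0 | split; [exact HN |]].
    intros j Hj.
    destruct (Nat.eqb_spec (S j) (S l)) as [E1 | E1];
      [| destruct (Nat.eqb_spec (S j) (S (S l))) as [E2 | E2]].
    + injection E1 as ->.
      rewrite (proj2 (Nat.eqb_neq l (S l))) by lia.
      rewrite <- Hm; field; lra.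
    + injection E2 as ->.
      rewrite Nat.eqb_refl.
      rewrite <- Hp; field; lra.
    + rewrite (proj2 (Nat.eqb_neq j (S l))) by lia.
      specialize (Hstd (S j) ltac:(lia) E1 E2).
      replace (S j - 1)%nat with j in Hstd by lia.
      rewrite Nat.add_1_r, Hx in Hstd.
      rewrite <- Hstd; field; lra.
  - intros (H0 & HN & H); split; [exact H0 | split; [exact HN | split; [| split]]].
    + intros [| j] Hj E1 E2; [lia |].
      specialize (H j ltac:(lia)).
      rewrite (proj2 (Nat.eqb_neq j (S l))), (proj2 (Nat.eqb_neq (S j) (S l))),
        (proj2 (Nat.eqb_neq (S j) (S (S l)))) in H by lia.
      replace (S j - 1)%nat with j by lia.
      rewrite Nat.add_1_r, Hx.
      apply Rmult_eq_reg_l with (h ^ 2); [| apply pow_nonzero; lra].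
      rewrite <- H; field; lra.
    + specialize (H l ltac:(lia)).
      rewrite Nat.eqb_refl, (proj2 (Nat.eqb_neq l (S l))) in H by lia.
      apply Rmult_eq_reg_l with (h ^ 2); [| apply pow_nonzero; lra].
      rewrite <- H; field; lra.
    + specialize (H (S l) ltac:(lia)).
      rewrite !Nat.eqb_refl, (proj2 (Nat.eqb_neq (S (S l)) (S l))) in H by lia.
      apply Rmult_eq_reg_l with (h ^ 2); [| apply pow_nonzero; lra].
      rewrite <- H; field; lra.
Qed.

(** * Consistency of the scheme with the exact solution *)

Lemma uniform_mesh (x : nat -> R) (h : R) :
  0 < h -> (forall j, x (S j) = x j + h) ->
  forall j l, (j <= l)%nat -> x j + INR (l - j) * h = x l.
Proof.
  intros Hh Hx j l Hjl; induction Hjl as [| l Hjl IH].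
  - rewrite Nat.sub_diag; simpl; ring.
  - rewrite Nat.sub_succ_l, S_INR, Hx, <- IH by exact Hjl; ring.
Qed.

(** On the interface edge the increment of [u] is [aI] plus a midpoint rule on each part of the
    cell. Expressing the right flux through the left one and the jump, the harmonic mean turns the
    two contributions into one flux. The largest errors, over all edges and nodes, fit into [c]. *)
Lemma scheme_consistency (xL xR xI h th k M aI bI : R) (N i : nat) (x : nat -> R)
    (beta f u bl fl ul vl br fr ur vr : R -> R) :
  0 < h -> 0 < th < 1 -> 0 < k -> (1 <= i)%nat -> (i + 2 <= N)%nat ->
  x 0%nat = xL -> x N = xR -> (forall j, x (S j) = x j + h) ->
  x i = xI - (1 - th) * h ->
  piece xL xI beta f u bl fl ul vl k M -> piece xI xR beta f u br fr ur vr k M ->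
  ul xL = u xL -> ur xR = u xR ->
  ur xI - ul xI = aI -> br xI * vr xI - bl xI * vl xI = bI ->
  let bm := beta ((x i + xI) / 2) in
  let bp := beta ((xI + x (S i)) / 2) in
  let bhat := weighted_harmonic_mean th bm bp in
  let fI := / 2 * (th * fr xI + (1 - th) * fl xI) in
  let K := edge_coeff beta x h bhat i in
  let G := node_rhs f x h th bm bp bhat aI bI fI i in
  let w := fun j => u (x j) in
  let c := 2 * M ^ 2 + 3 * M in
  0 <= c /\ (forall j, (j < N)%nat -> k <= K j) /\
  exists P : nat -> R,
    (forall j, (j < N)%nat -> Rabs (K j * (w (S j) - w j) - h * P j) <= c * h ^ 3) /\
    (forall j, (S j < N)%nat -> S j <> i -> j <> i ->
      Rabs (h * (P (S j) - P j) - G (S j)) <= c * h ^ 4) /\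
    (forall j, (S j < N)%nat -> S j = i \/ j = i ->
      Rabs (h * (P (S j) - P j) - G (S j)) <= c * h ^ 3).
Proof.
  intros Hh Hth Hk Hi HiN Hx0 HxN HxS Hxi PL PR HuL HuR Ha Hb bm bp bhat fI K G w c.
  assert (Hthh : 0 < th * h < h) by (split; [apply Rmult_lt_0_compat; lra | nra]).
  assert (HxSi : x (S i) = xI + th * h) by (rewrite HxS, Hxi; ring).
  assert (Hmesh := uniform_mesh x h Hh HxS).
  assert (Hmono : forall j l, (j <= l)%nat -> x j <= x l).
  { intros j l Hjl; rewrite <- (Hmesh j l Hjl).
    pose proof (pos_INR (l - j)); nra. }
  assert (Hleft : forall j, (j <= i)%nat -> xL <= x j <= xI - (1 - th) * h).
  { intros j Hj; rewrite <- Hxi, <- Hx0; split; apply Hmono; lia. }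
  assert (Hright : forall j, (S i <= j <= N)%nat -> xI + th * h <= x j <= xR).
  { intros j Hj; rewrite <- HxSi, <- HxN; split; apply Hmono; lia. }
  assert (HleftS : forall j, (j < i)%nat -> x j + h <= xI - (1 - th) * h)
    by (intros j Hj; rewrite <- HxS; apply Hleft; lia).
  assert (HrightS : forall j, (S i <= j < N)%nat -> x j + h <= xR)
    by (intros j Hj; rewrite <- HxS; apply Hright; lia).
  (* A full cell lies on each side of the interface cell, so both interface stencils stay inside the
     domain. *)
  assert (HiL := HleftS 0%nat ltac:(lia)); rewrite Hx0 in HiL.
  assert (HiR := HrightS (S i) ltac:(lia)); rewrite HxSi in HiR.
  assert (HwL : forall j, (j <= i)%nat -> w j = ul (x j)).
  { intros j Hj; unfold w; destruct (Req_dec (x j) xL) as [-> | Hne]; [symmetry; exact HuL |].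
    specialize (Hleft j Hj); symmetry; apply (pc_u PL); lra. }
  assert (HwR : forall j, (S i <= j <= N)%nat -> w j = ur (x j)).
  { intros j Hj; unfold w; destruct (Req_dec (x j) xR) as [-> | Hne]; [symmetry; exact HuR |].
    specialize (Hright j Hj); symmetry; apply (pc_u PR); lra. }
  set (pl := fun y => bl y * vl y); set (pr := fun y => br y * vr y).
  set (ml := (x i + xI) / 2); set (mr := (xI + x (S i)) / 2).
  assert (Hml : ml = xI - (1 - th) * h / 2) by (unfold ml; lra).
  assert (Hmr : mr = xI + th * h / 2) by (unfold mr; lra).
  assert (Ebm : bm = bl ml)
    by (symmetry; apply (pc_beta PL); fold ml; lra).
  assert (Ebp : bp = br mr)
    by (symmetry; apply (pc_beta PR); fold mr; lra).
  assert (Hbm : k <= bm <= M)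
    by (rewrite Ebm; apply (pc_bound PL); lra).
  assert (Hbp : k <= bp <= M)
    by (rewrite Ebp; apply (pc_bound PR); lra).
  destruct (weighted_harmonic_mean_bounds th bm bp k M Hth Hk Hbm Hbp) as (Hbhat & Hratio & Hsum).
  fold bhat in Hbhat, Hratio, Hsum.
  assert (HM : 0 < M) by lra.
  assert (Hc : 3 * M <= c) by (unfold c; pose proof (pow2_ge_0 M); lra).
  assert (Hh3 : 0 < h ^ 3) by (apply pow_lt; exact Hh).
  assert (Hh4 : 0 < h ^ 4) by (apply pow_lt; exact Hh).
  assert (EbL : forall j, (j < i)%nat -> beta (x j + h / 2) = bl (x j + h / 2)).
  { intros j Hj; symmetry; apply (pc_beta PL).
    specialize (Hleft j ltac:(lia)); specialize (HleftS j Hj); lra. }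
  assert (EbR : forall j, (S i <= j < N)%nat -> beta (x j + h / 2) = br (x j + h / 2)).
  { intros j Hj; symmetry; apply (pc_beta PR).
    specialize (Hright j ltac:(lia)); specialize (HrightS j Hj); lra. }
  (* Between the midpoints [ml] and [mr] the flux jumps by [bI] and changes by [f] times the lengths
     [(1 - th) * h / 2] and [th * h / 2], which together give [h * fI]. *)
  assert (HE3 : Rabs (pr mr - pl ml - bI - h * fI) <= 2 * M * h ^ 2).
  { pose proof (pc_flux_one PR xI mr xI h
      ltac:(lra) ltac:(lra) ltac:(lra) ltac:(apply Rabs_le; lra) ltac:(apply Rabs_le; lra)) as H1.
    pose proof (pc_flux_one PL ml xI xI h
      ltac:(lra) ltac:(lra) ltac:(lra) ltac:(apply Rabs_le; lra) ltac:(apply Rabs_le; lra)) as H2.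
    fold (pr mr) (pr xI) in H1; fold (pl ml) (pl xI) in H2; fold (pr xI) (pl xI) in Hb.
    replace (pr mr - pl ml - bI - h * fI) with
      ((pr mr - pr xI - (mr - xI) * fr xI) + (pl xI - pl ml - (xI - ml) * fl xI))
      by (rewrite <- Hb; unfold fI; rewrite Hml, Hmr; field).
    eapply Rle_trans; [apply Rabs_triang | lra]. }
  (* [P i] is chosen so that the jump terms of both interface equations cancel:
     [bhat * (th / bp + (1 - th) / bm) = 1]. *)
  set (P := fun j => if lt_dec j i then pl (x j + h / 2)
                     else if Nat.eqb j i then pl ml + bhat * aI / h + bhat * th / bp * (bI + h * fI)
                     else pr (x j + h / 2)).
  assert (PLe : forall j, (j < i)%nat -> P j = pl (x j + h / 2))
    by (intros j Hj; unfold P; destruct (lt_dec j i); [reflexivity | lia]).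
  assert (PIe : P i = pl ml + bhat * aI / h + bhat * th / bp * (bI + h * fI))
    by (unfold P; destruct (lt_dec i i); [lia | rewrite Nat.eqb_refl; reflexivity]).
  assert (PRe : forall j, (S i <= j)%nat -> P j = pr (x j + h / 2)).
  { intros j Hj; unfold P; destruct (lt_dec j i); [lia |].
    rewrite (proj2 (Nat.eqb_neq j i)) by lia; reflexivity. }
  split; [lra |]; split.
  { intros j Hj; unfold K, edge_coeff; destruct (Nat.eqb_spec j i) as [E | E]; [lra |].
    destruct (le_lt_dec j i).
    - rewrite EbL by lia; apply (pc_bound PL).
      specialize (Hleft j ltac:(lia)); specialize (HleftS j ltac:(lia)); lra.
    - rewrite EbR by lia; apply (pc_bound PR).
      specialize (Hright j ltac:(lia)); specialize (HrightS j ltac:(lia)); lra. }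
  exists P; split; [| split].
  - intros j Hj; destruct (lt_eq_lt_dec j i) as [[Hlt | ->] | Hgt].
    + rewrite HwL, HwL, PLe by lia; unfold K, edge_coeff.
      rewrite (proj2 (Nat.eqb_neq j i)), EbL by lia.
      pose proof (Hleft j ltac:(lia)) as H1; pose proof (HleftS j Hlt) as H2.
      pose proof (pc_u_mid PL (x j) (x (S j))
        ltac:(rewrite HxS; lra) ltac:(rewrite HxS; lra)) as H3.
      replace ((x j + x (S j)) / 2) with (x j + h / 2) in H3 by (rewrite HxS; field).
      replace (x (S j) - x j) with h in H3 by (rewrite HxS; ring).
      pose proof (pc_bound PL (x j + h / 2) ltac:(lra)) as H4.
      unfold pl.
      replace (bl (x j + h / 2) * (ul (x (S j)) - ul (x j)) - h * (bl (x j + h / 2) * vl (x j + h / 2)))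
        with (bl (x j + h / 2) * (ul (x (S j)) - ul (x j) - h * vl (x j + h / 2))) by ring.
      rewrite Rabs_mult, (Rabs_pos_eq (bl _)) by lra.
      apply Rle_trans with (M * (M * h ^ 3)).
      * apply Rmult_le_compat; [lra | apply Rabs_pos | lra | exact H3].
      * replace (M * (M * h ^ 3)) with (M ^ 2 * h ^ 3) by ring.
        apply Rmult_le_compat_r; [lra |]; unfold c; pose proof (pow2_ge_0 M); lra.
    + rewrite (HwR (S i)), (HwL i), PIe by lia; unfold K, edge_coeff; rewrite Nat.eqb_refl.
      pose proof (pc_u_mid PL (x i) xI ltac:(lra) ltac:(lra)) as H1.
      pose proof (pc_u_mid PR xI (x (S i)) ltac:(lra) ltac:(lra)) as H2.
      fold ml in H1; fold mr in H2.
      (* [E1] and [E2] are the midpoint errors on the two parts of the cell, and [E3] is the error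
         in the flux jump. *)
      set (E1 := ul xI - ul (x i) - (xI - x i) * vl ml) in H1.
      set (E2 := ur (x (S i)) - ur xI - (x (S i) - xI) * vr mr) in H2.
      set (E3 := pr mr - pl ml - bI - h * fI) in HE3.
      replace (bhat * (ur (x (S i)) - ul (x i)) -
        h * (pl ml + bhat * aI / h + bhat * th / bp * (bI + h * fI)))
        with (bhat * (E1 + E2) + h * (bhat * th / bp) * E3).
      * assert (B1 : Rabs E1 <= M * h ^ 3).
        { eapply Rle_trans; [exact H1 |]; apply Rmult_le_compat_l; [lra |].
          apply pow_incr; lra. }
        assert (B2 : Rabs E2 <= M * h ^ 3).
        { eapply Rle_trans; [exact H2 |]; apply Rmult_le_compat_l; [lra |].
          apply pow_incr; lra. }
        eapply Rle_trans; [apply Rabs_triang |].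
        assert (Rabs (bhat * (E1 + E2)) <= M * (2 * (M * h ^ 3))).
        { rewrite Rabs_mult, (Rabs_pos_eq bhat) by lra.
          apply Rmult_le_compat; [lra | apply Rabs_pos | lra |].
          eapply Rle_trans; [apply Rabs_triang | lra]. }
        assert (Rabs (h * (bhat * th / bp) * E3) <= h * 1 * (2 * M * h ^ 2)).
        { rewrite !(Rabs_mult _ E3), (Rabs_pos_eq (h * _)) by (apply Rmult_le_pos; lra).
          apply Rmult_le_compat; [apply Rmult_le_pos; lra | apply Rabs_pos | | exact HE3].
          apply Rmult_le_compat_l; lra. }
        replace (c * h ^ 3) with
          (M * (2 * (M * h ^ 3)) + h * 1 * (2 * M * h ^ 2) + M * h ^ 3) by (unfold c; ring).
        pose proof (Rmult_lt_0_compat M (h ^ 3) HM Hh3); lra.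
      * assert (Evl : vl ml = pl ml / bm) by (unfold pl; rewrite Ebm; field; lra).
        assert (Evr : vr mr = pr mr / bp) by (unfold pr; rewrite Ebp; field; lra).
        apply Rminus_diag_uniq.
        (* After the derivatives are written as flux over coefficient, the two sides differ by a
           multiple of the harmonic mean identity. *)
        transitivity (h * pl ml * (1 - bhat * (th / bp + (1 - th) / bm))).
        -- unfold E1, E2, E3; rewrite Evl, Evr, HxSi, Hxi, <- Ha; field; lra.
        -- rewrite Hsum; ring.
    + rewrite HwR, HwR, PRe by lia; unfold K, edge_coeff.
      rewrite (proj2 (Nat.eqb_neq j i)), EbR by lia.
      pose proof (Hright j ltac:(lia)) as H1; pose proof (HrightS j ltac:(lia)) as H2.
      pose proof (pc_u_mid PR (x j) (x (S j))
        ltac:(rewrite HxS; lra) ltac:(rewrite HxS; lra)) as H3.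
      replace ((x j + x (S j)) / 2) with (x j + h / 2) in H3 by (rewrite HxS; field).
      replace (x (S j) - x j) with h in H3 by (rewrite HxS; ring).
      pose proof (pc_bound PR (x j + h / 2) ltac:(lra)) as H4.
      unfold pr.
      replace (br (x j + h / 2) * (ur (x (S j)) - ur (x j)) - h * (br (x j + h / 2) * vr (x j + h / 2)))
        with (br (x j + h / 2) * (ur (x (S j)) - ur (x j) - h * vr (x j + h / 2))) by ring.
      rewrite Rabs_mult, (Rabs_pos_eq (br _)) by lra.
      apply Rle_trans with (M * (M * h ^ 3)).
      * apply Rmult_le_compat; [lra | apply Rabs_pos | lra | exact H3].
      * replace (M * (M * h ^ 3)) with (M ^ 2 * h ^ 3) by ring.
        apply Rmult_le_compat_r; [lra |]; unfold c; pose proof (pow2_ge_0 M); lra.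
  (* Both adjacent edge midpoints lie on the same side and are centred at the node, so the midpoint
     rule for the flux applies. *)
  - intros j Hj E1 E2; unfold G, node_rhs.
    rewrite (proj2 (Nat.eqb_neq (S j) i)), (proj2 (Nat.eqb_neq (S j) (S i))) by lia.
    destruct (le_lt_dec (S j) i) as [Hle | Hgt].
    + rewrite !PLe by lia.
      pose proof (Hleft j ltac:(lia)) as H1; pose proof (HleftS (S j) ltac:(lia)) as H2.
      rewrite <- (pc_f PL) by (rewrite HxS in *; lra).
      rewrite HxS in *.
      pose proof (pc_flux_mid PL (x j + h / 2) (x j + h + h / 2)
        ltac:(lra) ltac:(lra)) as H3.
      fold (pl (x j + h / 2)) (pl (x j + h + h / 2)) in H3.
      replace (x j + h + h / 2 - (x j + h / 2)) with h in H3 by ring.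
      replace ((x j + h / 2 + (x j + h + h / 2)) / 2) with (x j + h) in H3 by field.
      replace (h * (pl (x j + h + h / 2) - pl (x j + h / 2)) - h ^ 2 * fl (x j + h))
        with (h * (pl (x j + h + h / 2) - pl (x j + h / 2) - h * fl (x j + h))) by ring.
      rewrite Rabs_mult, (Rabs_pos_eq h) by lra.
      apply Rle_trans with (h * (M * h ^ 3)); [apply Rmult_le_compat_l; lra |].
      replace (h * (M * h ^ 3)) with (M * h ^ 4) by ring.
      apply Rmult_le_compat_r; lra.
    + rewrite !PRe by lia.
      pose proof (Hright j ltac:(lia)) as H1; pose proof (HrightS (S j) ltac:(lia)) as H2.
      rewrite <- (pc_f PR) by (rewrite HxS in *; lra).
      rewrite HxS in *.
      pose proof (pc_flux_mid PR (x j + h / 2) (x j + h + h / 2)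
        ltac:(lra) ltac:(lra)) as H3.
      fold (pr (x j + h / 2)) (pr (x j + h + h / 2)) in H3.
      replace (x j + h + h / 2 - (x j + h / 2)) with h in H3 by ring.
      replace ((x j + h / 2 + (x j + h + h / 2)) / 2) with (x j + h) in H3 by field.
      replace (h * (pr (x j + h + h / 2) - pr (x j + h / 2)) - h ^ 2 * fr (x j + h))
        with (h * (pr (x j + h + h / 2) - pr (x j + h / 2) - h * fr (x j + h))) by ring.
      rewrite Rabs_mult, (Rabs_pos_eq h) by lra.
      apply Rle_trans with (h * (M * h ^ 3)); [apply Rmult_le_compat_l; lra |].
      replace (h * (M * h ^ 3)) with (M * h ^ 4) by ring.
      apply Rmult_le_compat_r; lra.
  - intros j Hj [Hji | ->]; unfold G, node_rhs.
    (* At node [i] the jump terms of [P i] equal those of the right-hand side. What remains is the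
       flux increment from [x i - h / 2] to [ml], of length [h * ((2 - th) / 2)]. *)
    + rewrite Hji, Nat.eqb_refl, PIe, (PLe j) by lia.
      rewrite <- (pc_f PL (x i)) by lra.
      assert (Hxj : x j + h = x i) by (rewrite <- HxS, Hji; reflexivity).
      pose proof (Hleft j ltac:(lia)) as H1.
      pose proof (pc_flux_one PL (x j + h / 2) ml (x i) h
        ltac:(lra) ltac:(lra) ltac:(lra) ltac:(apply Rabs_le; lra) ltac:(apply Rabs_le; lra)) as H3.
      fold (pl ml) (pl (x j + h / 2)) in H3.
      replace (ml - (x j + h / 2)) with (h * ((2 - th) / 2)) in H3 by lra.
      match goal with |- Rabs ?e <= _ =>
        replace e with (h * (pl ml - pl (x j + h / 2) - h * ((2 - th) / 2) * fl (x i)))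
          by (field; lra) end.
      rewrite Rabs_mult, (Rabs_pos_eq h) by lra.
      apply Rle_trans with (h * (M * h ^ 2)); [apply Rmult_le_compat_l; lra |].
      replace (h * (M * h ^ 2)) with (M * h ^ 3) by ring.
      apply Rmult_le_compat_r; lra.
    (* At node [S i] the jump terms carry the complementary weights. By the harmonic mean identity
       they add up to the full flux jump, whose error [E3] joins the one-point error. *)
    + rewrite (proj2 (Nat.eqb_neq (S i) i)), Nat.eqb_refl, PIe, PRe by lia.
      rewrite <- (pc_f PR (x (S i))) by lra.
      pose proof (pc_flux_one PR mr (x (S i) + h / 2) (x (S i)) h
        ltac:(lra) ltac:(lra) ltac:(lra) ltac:(apply Rabs_le; lra) ltac:(apply Rabs_le; lra)) as H3.
      fold (pr mr) (pr (x (S i) + h / 2)) in H3.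
      replace (x (S i) + h / 2 - mr) with (h * ((1 + th) / 2)) in H3 by lra.
      set (E1 := pr (x (S i) + h / 2) - pr mr - h * ((1 + th) / 2) * fr (x (S i))) in H3.
      set (E3 := pr mr - pl ml - bI - h * fI) in HE3.
      match goal with |- Rabs ?e <= _ => replace e with (h * (E1 + E3)) end.
      * rewrite Rabs_mult, (Rabs_pos_eq h) by lra.
        apply Rle_trans with (h * (3 * M * h ^ 2)).
        -- apply Rmult_le_compat_l; [lra |]; eapply Rle_trans; [apply Rabs_triang | lra].
        -- replace (h * (3 * M * h ^ 2)) with (3 * M * h ^ 3) by ring.
           apply Rmult_le_compat_r; lra.
      * apply Rminus_diag_uniq.
        transitivity (h * (bI + h * fI) * (bhat * (th / bp + (1 - th) / bm) - 1)).
        -- unfold E1, E3; field; lra.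
        -- rewrite Hsum; ring.
Qed.

(** * Solvability and second-order convergence *)

Theorem theorem1 (xL xR xI : R) (hI : xL < xI < xR)
    (beta f : R -> R)
    (hbetaL : extends_smoothly_pos xL xI beta)
    (hbetaR : extends_smoothly_pos xI xR beta)
    (hfL : extends_smoothly xL xI f)
    (hfR : extends_smoothly xI xR f)
    (fIm fIp : R) (hfIm : left_lim f xI fIm) (hfIp : right_lim f xI fIp)
    (aI bI gL gR : R)
    (u : R -> R) (hu : exact_solution xL xR xI beta f aI bI gL gR u) :
  exists C h0 : R, 0 < C /\ 0 < h0 /\
    forall N i : nat, (1 <= N)%nat ->
      spacing xL xR N <= h0 ->
      grid xL xR N i < xI < grid xL xR N (i + 1) ->
      exists U : nat -> R,
        scheme xL xR xI beta f aI bI gL gR fIm fIp N i U /\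
        (forall V : nat -> R,
           scheme xL xR xI beta f aI bI gL gR fIm fIp N i V ->
           forall j : nat, (j <= N)%nat -> V j = U j) /\
        discrete_norm xL xR N (fun j => U j - u (grid xL xR N j))
          <= C * spacing xL xR N ^ 2.
Proof.
  destruct hu as [(ul & Hul & Eul) (ur & Hur & Eur) Hode (um & up & Hum & Hup & Ha)
    (betam & betap & uxm & uxp & Hbm & Hbp & Hvm & Hvp & Hb) HgL HgR].
  destruct (piece_exists xL xI beta f u ul ltac:(lra) hbetaL hfL Hul
    ltac:(intros; apply Eul; lra) ltac:(intros; apply Hode; lra))
    as (bl & fl & vl & kl & Ml & Hkl & HMl & PL).
  destruct (piece_exists xI xR beta f u ur ltac:(lra) hbetaR hfR Hur
    ltac:(intros; apply Eur; lra) ltac:(intros; apply Hode; lra))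
    as (br & fr & vr & kr & Mr & Hkr & HMr & PR).
  set (k := Rmin kl kr); set (M := Ml + Mr).
  assert (Hk : 0 < k) by (apply Rmin_glb_lt; assumption).
  apply (piece_weaken _ _ _ _ k M) in PL; [| apply Rmin_l | unfold M; lra].
  apply (piece_weaken _ _ _ _ k M) in PR; [| apply Rmin_r | unfold M; lra].
  (* All one-sided limits in the hypotheses are end point values of the extensions. *)
  assert (EfL : fIm = fl xI).
  { destruct (pc_D_f PL) as (d & Hd).
    apply (left_lim_D_on xL xI _ fl d f); try assumption; [lra | apply PL]. }
  assert (EfR : fIp = fr xI).
  { destruct (pc_D_f PR) as (d & Hd).
    apply (right_lim_D_on xI xR _ fr d f); try assumption; [lra | apply PR]. }
  assert (EuL : um = ul xI).
  { destruct (pc_D_u PL) as (d & Hd).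
    apply (left_lim_D_on xL xI _ ul d u); try assumption; [lra | apply PL]. }
  assert (EuR : up = ur xI).
  { destruct (pc_D_u PR) as (d & Hd).
    apply (right_lim_D_on xI xR _ ur d u); try assumption; [lra | apply PR]. }
  assert (EbL : betam = bl xI).
  { destruct (pc_D_beta PL) as (d & Hd).
    apply (left_lim_D_on xL xI _ bl d beta); try assumption; [lra | apply PL]. }
  assert (EbR : betap = br xI).
  { destruct (pc_D_beta PR) as (d & Hd).
    apply (right_lim_D_on xI xR _ br d beta); try assumption; [lra | apply PR]. }
  assert (EvL : uxm = vl xI).
  { destruct (pc_D_v PL) as (d & Hd).
    apply (left_lim_D_on xL xI _ vl d (Derive u)); try assumption; [lra | apply PL]. }
  assert (EvR : uxp = vr xI).
  { destruct (pc_D_v PR) as (d & Hd).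
    apply (right_lim_D_on xI xR _ vr d (Derive u)); try assumption; [lra | apply PR]. }
  subst fIm fIp um up betam betap uxm uxp.
  set (c := 2 * M ^ 2 + 3 * M).
  set (E := 2 * c * (xR - xL + 3) * (xR - xL) / k).
  assert (HM : 0 < M) by (unfold M; lra).
  assert (Hc : 0 < c) by (unfold c; pose proof (pow2_ge_0 M); lra).
  assert (HE : 0 < E).
  { unfold E; apply Rdiv_lt_0_compat; [| exact Hk].
    repeat apply Rmult_lt_0_compat; lra. }
  (* The square root passes from the maximum norm to the discrete norm. The threshold on the spacing
     forces [1 <= i] and [i + 2 <= N]. *)
  exists (sqrt (xR - xL) * E), (Rmin ((xI - xL) / 2) ((xR - xI) / 2)).
  split; [apply Rmult_lt_0_compat; [apply sqrt_lt_R0; lra | exact HE] |].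
  split; [apply Rmin_glb_lt; lra |].
  intros N i HN Hh0 Hi.
  assert (HN' : 0 < INR N) by (apply lt_0_INR; lia).
  set (h := spacing xL xR N) in *.
  assert (Hh : 0 < h) by (apply Rdiv_lt_0_compat; lra).
  assert (HNh : INR N * h = xR - xL) by (unfold h, spacing; field; lra).
  assert (Hh1 : h <= (xI - xL) / 2) by (eapply Rle_trans; [exact Hh0 | apply Rmin_l]).
  assert (Hh2 : h <= (xR - xI) / 2) by (eapply Rle_trans; [exact Hh0 | apply Rmin_r]).
  assert (Hi1 : (1 <= i)%nat).
  { destruct i as [| i]; [| lia]; unfold grid in Hi; fold h in Hi; simpl in Hi; lra. }
  assert (HiN : (i + 2 <= N)%nat).
  { apply INR_le; rewrite plus_INR; apply Rmult_le_reg_r with (1 := Hh).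
    unfold grid in Hi; fold h in Hi; simpl (INR 2); lra. }
  set (x := grid xL xR N) in *.
  set (th := (x (i + 1)%nat - xI) / h).
  assert (HxS : forall j, x (S j) = x j + h)
    by (intros j; unfold x, grid; fold h; rewrite S_INR; ring).
  assert (Hxi1 : x (i + 1)%nat = x i + h) by (rewrite Nat.add_1_r; apply HxS).
  assert (Hthh : th * h = x (i + 1)%nat - xI) by (unfold th; field; lra).
  assert (Hth : 0 < th < 1)
    by (split; apply Rmult_lt_reg_r with (1 := Hh); lra).
  destruct (scheme_consistency xL xR xI h th k M aI bI N i x beta f u bl fl ul vl br fr ur vr)
    as (_ & HK & P & HP1 & HP2 & HP3); try assumption; try lra.
  - unfold x, grid; simpl; ring.
  - unfold x, grid; fold h; lra.
  - apply Eul; lra.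
  - apply Eur; lra.
  - rewrite <- Nat.add_1_r in HK, HP1, HP2, HP3.
    destruct (tridiagonal_exists N _
      (node_rhs f x h th (beta ((x i + xI) / 2)) (beta ((xI + x (i + 1)%nat) / 2))
        (weighted_harmonic_mean th (beta ((x i + xI) / 2)) (beta ((xI + x (i + 1)%nat) / 2)))
        aI bI (/ 2 * (th * fr xI + (1 - th) * fl xI)) i) gL gR k Hk HN HK) as (U & HU).
    assert (Hequiv := fun V => scheme_tridiagonal xL xR xI beta f aI bI gL gR (fl xI) (fr xI)
      N i V Hh Hi1 HiN).
    cbv zeta in Hequiv; fold x h th in Hequiv.
    exists U; split; [apply Hequiv; exact HU | split].
    + intros V HV; apply Hequiv in HV.
      apply (tridiagonal_unique N _ _ V U gL gR k Hk HN HK HV HU).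
    + rewrite Rmult_assoc.
      apply discrete_norm_le; [lra | exact HN | apply Rmult_le_pos; [lra | apply pow2_ge_0] |].
      assert (Hx0 : x 0%nat = xL) by (unfold x, grid; simpl; ring).
      assert (HxN : x N = xR) by (unfold x, grid; fold h; lra).
      (* The boundary data become values of [u] at the end nodes, so that the error vanishes
         there. *)
      rewrite <- HgL, <- HgR in HU.
      replace (u xL) with (u (x 0%nat)) in HU by (rewrite Hx0; reflexivity).
      replace (u xR) with (u (x N)) in HU by (rewrite HxN; reflexivity).
      exact (tridiagonal_convergence N i _ _ P U (fun j => u (x j)) k h c (xR - xL) Hk Hh
        (Rlt_le _ _ Hc) HN HNh HK HU HP1 HP2 HP3).
Qed.
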